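(* For $(d,e,f,g)\in\mathbb C^4$ let $E_{d,e,f,g}\subset\mathbb P^2$ be the cubic curve $x^3+y^3=d\,xyz+e\,xz^2+f\,yz^2+g\,z^3$. Set $$F=-3ef+\tfrac92 dg-\tfrac1{48}d^4,\qquad G=-e^3-f^3+\tfrac{27}4g^2+\tfrac34 efd^2-\tfrac58 gd^3-\tfrac1{864}d^6,$$ and define the following loci in $\mathbb C^4$: - $N$: $4F^3+27G^2=0$; - $C$: $F=G=0$; - $Q$: $f=\rho e$ and $g=\frac{1}{27}d(9\rho^2e-d^2)$ for some $\rho$ with $\rho^3=1$; - $P$: $f=\rho e=\frac{\rho^2d^2}4$ and $g=\frac{5d^3}{108}$ for some $\rho$ with $\rho^3=1$; - $T$: $e=f=0$ and $g=-\frac{d^3}{27}$; - $S$: $d=e=f=g=0$. Then $E_{d,e,f,g}$ is singular if and only if $(d,e,f,g)\in N$, and in this case it is: 1. an irreducible cubic with a node, if $(d,e,f,g)\in N\smallsetminus(C\cup Q)$; 2. an irreducible cubic with a cusp, if $(d,e,f,g)\in C\smallsetminus P$; 3. the union of a nonsingular conic and a line meeting transversally at two points, if $(d,e,f,g)\in Q\smallsetminus(P\cup T)$; 4. the union of a nonsingular conic and a line tangent to it, if $(d,e,f,g)\in P\smallsetminus S$; 5. the union of three nonconcurrent lines, if $(d,e,f,g)\in T\smallsetminus S$; 6. the union of three distinct concurrent lines, if $(d,e,f,g)\in S$. Moreover $P=C\cap Q$ and $S=P\cap T$.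
   Context: These curves are the possible fibers of $E_6$ elliptic fibrations, i.e. fibrations defined by the equation $x^3+y^3=d\,xyz+e\,xz^2+f\,yz^2+g\,z^3$ in a projective plane bundle over a base, with $d,e,f,g$ varying over the base. *)

(* Defs.v *)
From mathcomp Require Import all_boot all_order all_algebra.
From mathcomp Require Import classical_sets reals.
From mathcomp Require Import complex mpoly.

Set Implicit Arguments.
Unset Strict Implicit.
Unset Printing Implicit Defensive.

Import GRing.Theory.

Local Open Scope classical_set_scope.
Local Open Scope ring_scope.

(* Plane projective curves over K are given by their equations, i.e. nonzero
   forms in {mpoly K[3]}, the variables 'X_0, 'X_1, 'X_2 standing for x, y, z;
   a form and its nonzero multiples define the same curve.  Accordingly the
   equation of a union of curves is the product of their equations (the union
   is meant with its scheme structure, each listed component occurring once).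
   A point of the projective plane is a nonzero row vector P : 'rV[K]_3 of
   homogeneous coordinates; two of them are the same point when they span the
   same line of K^3. *)

Section Curves.

Variable K : fieldType.

Implicit Types (f q l : {mpoly K[3]}) (P Q : 'rV[K]_3).

Definition same_point P Q : bool := (P == Q)%MS.

Definition on_curve f P : Prop := P != 0 /\ f.@[P 0] = 0.

Definition gradient f P : 'rV[K]_3 := \row_i (f^`M(i)).@[P 0].

Definition singular_point f P : Prop := on_curve f P /\ gradient f P = 0.

Definition singular_curve f : Prop := exists P, singular_point f P.

Definition irreducible_mpoly n (p : {mpoly K[n]}) : Prop :=
  [/\ p != 0, p \isn't a GRing.unit &
      forall p1 p2, p = p1 * p2 ->
        p1 \is a GRing.unit \/ p2 \is a GRing.unit].

Definition proportional n (p1 p2 : {mpoly K[n]}) : Prop :=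
  exists2 c : K, c != 0 & p2 = c *: p1.

(* When P, u, v is a basis of K^3, (s, t) |-> P + s u + t v is an affine chart
   of the projective plane centered at P, and the following is the equation of
   the curve f in this chart. *)
Definition local_equation f (P u v : 'rV[K]_3) : {mpoly K[2]} :=
  f \mPo [tuple (P 0 i)%:MP + u 0 i *: 'X_0 + v 0 i *: 'X_1 | i < 3].

Definition is_frame (P u v : 'rV[K]_3) : bool :=
  row_free (col_mx P (col_mx u v)).

Definition homog_part (d : nat) (p : {mpoly K[2]}) : {mpoly K[2]} :=
  pihomog mdeg d p.

(* A node is a double point with two distinct tangents.  This does not depend
   on the chart used to compute the tangents. *)
Definition node_at f P : Prop :=
  exists u v : 'rV[K]_3, is_frame P u v /\
  let phi := local_equation f P u v in
  [/\ homog_part 0 phi = 0, homog_part 1 phi = 0 &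
      exists a b : {mpoly K[2]},
        [/\ a != 0 /\ a \is 1.-homog, b != 0 /\ b \is 1.-homog,
            ~ proportional a b & homog_part 2 phi = a * b]].

(* A cusp is a double point with only one tangent, a = 0, whose intersection
   multiplicity with the curve is the least possible, 3, i.e. such that a does
   not divide the cubic part of the local equation.  Again this does not depend
   on the chart. *)
Definition cusp_at f P : Prop :=
  exists u v : 'rV[K]_3, is_frame P u v /\
  let phi := local_equation f P u v in
  [/\ homog_part 0 phi = 0, homog_part 1 phi = 0 &
      exists a : {mpoly K[2]},
        [/\ a != 0, a \is 1.-homog, homog_part 2 phi = a ^+ 2 &
            ~ exists h : {mpoly K[2]}, homog_part 3 phi = a * h]].

Definition is_line l : Prop := l != 0 /\ l \is 1.-homog.

Definition nonsingular_conic q : Prop :=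
  [/\ q != 0, q \is 2.-homog & ~ singular_curve q].

(* The curves are nonsingular at the common point P, with distinct tangent
   lines there. *)
Definition transversal_at f q P : Prop :=
  [/\ on_curve f P, on_curve q P &
      \rank (col_mx (gradient f P) (gradient q P)) = 2%N].

(* The curves are nonsingular at the common point P, with the same tangent
   line there. *)
Definition tangent_at f q P : Prop :=
  [/\ on_curve f P /\ on_curve q P,
      gradient f P != 0, gradient q P != 0 &
      (gradient f P == gradient q P)%MS].

Definition nodal_irreducible f : Prop :=
  irreducible_mpoly f /\
  exists P, node_at f P /\ forall Q, singular_point f Q -> same_point Q P.

Definition cuspidal_irreducible f : Prop :=
  irreducible_mpoly f /\
  exists P, cusp_at f P /\ forall Q, singular_point f Q -> same_point Q P.

Definition conic_and_transversal_line f : Prop :=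
  exists q l, [/\ nonsingular_conic q, is_line l, f = q * l &
    exists P1 P2, [/\ transversal_at q l P1, transversal_at q l P2,
      ~~ same_point P1 P2 &
      forall P, on_curve q P -> on_curve l P ->
        same_point P P1 \/ same_point P P2]].

Definition conic_and_tangent_line f : Prop :=
  exists q l, [/\ nonsingular_conic q, is_line l, f = q * l &
    exists P, tangent_at q l P].

Definition concurrent (l1 l2 l3 : {mpoly K[3]}) : Prop :=
  exists P, [/\ on_curve l1 P, on_curve l2 P & on_curve l3 P].

Definition three_nonconcurrent_lines f : Prop :=
  exists l1 l2 l3, [/\ is_line l1, is_line l2, is_line l3,
    f = l1 * l2 * l3 & ~ concurrent l1 l2 l3].

Definition three_distinct_concurrent_lines f : Prop :=
  exists l1 l2 l3, [/\ [/\ is_line l1, is_line l2 & is_line l3],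
    f = l1 * l2 * l3,
    [/\ ~ proportional l1 l2, ~ proportional l1 l3 & ~ proportional l2 l3] &
    concurrent l1 l2 l3].

Definition E6_cubic (d e f g : K) : {mpoly K[3]} :=
  'X_0 ^+ 3 + 'X_1 ^+ 3
  - (d *: ('X_0 * 'X_1 * 'X_2) + e *: ('X_0 * 'X_2 ^+ 2)
     + f *: ('X_1 * 'X_2 ^+ 2) + g *: 'X_2 ^+ 3).

Definition E6_F (d e f g : K) : K :=
  - 3 * e * f + 9 / 2 * d * g - 1 / 48 * d ^+ 4.

Definition E6_G (d e f g : K) : K :=
  - e ^+ 3 - f ^+ 3 + 27 / 4 * g ^+ 2 + 3 / 4 * e * f * d ^+ 2
  - 5 / 8 * g * d ^+ 3 - 1 / 864 * d ^+ 6.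

Definition locusN : set (K * K * K * K) :=
  [set p | let: (d, e, f, g) := p in
    4 * E6_F d e f g ^+ 3 + 27 * E6_G d e f g ^+ 2 = 0].

Definition locusC : set (K * K * K * K) :=
  [set p | let: (d, e, f, g) := p in
    E6_F d e f g = 0 /\ E6_G d e f g = 0].

Definition locusQ : set (K * K * K * K) :=
  [set p | let: (d, e, f, g) := p in
    exists rho : K, [/\ rho ^+ 3 = 1, f = rho * e &
      g = 1 / 27 * d * (9 * rho ^+ 2 * e - d ^+ 2)]].

Definition locusP : set (K * K * K * K) :=
  [set p | let: (d, e, f, g) := p in
    exists rho : K, [/\ rho ^+ 3 = 1, f = rho * e,
      rho * e = rho ^+ 2 * d ^+ 2 / 4 & g = 5 * d ^+ 3 / 108]].

Definition locusT : set (K * K * K * K) :=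
  [set p | let: (d, e, f, g) := p in
    [/\ e = 0, f = 0 & g = - (d ^+ 3 / 27)]].

Definition locusS : set (K * K * K * K) :=
  [set p | let: (d, e, f, g) := p in
    [/\ d = 0, e = 0, f = 0 & g = 0]].

End Curves.

Arguments locusN {K}.
Arguments locusC {K}.
Arguments locusQ {K}.
Arguments locusP {K}.
Arguments locusT {K}.
Arguments locusS {K}.

(* Main.v *)
Require Import Defs.
From mathcomp Require Import all_boot all_order all_algebra.
From mathcomp Require Import ring zify.
From mathcomp Require Import classical_sets reals.
From mathcomp Require Import complex mpoly.

(* A singular point of the cubic is affine, say (a : b : 1), and the vanishing
   of the gradient there determines e, f and g as polynomials in d, a, b.
   Translated to this point the equation is
     u^3 + v^3 + z (3 a u^2 - d u v + 3 b v^2),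
   and F = - t^2 / 48, G = - t^3 / 864 for the discriminant t = d^2 - 36 a b of
   the quadratic part; so N contains the parameters of singular cubics, and t
   decides between node and cusp.  Conversely, on N such a t exists, which
   gives a linear system for (a, b).  Its determinant vanishes only on Q, where
   a line splits off the cubic explicitly.  Outside Q the quadratic and cubic
   parts above have no common zero, so that the cubic contains no line and has
   no other singular point. *)

Set Implicit Arguments.
Unset Strict Implicit.
Unset Printing Implicit Defensive.

Import GRing.Theory Num.Theory.

Local Open Scope classical_set_scope.
Local Open Scope ring_scope.

(** * Points of the projective plane in coordinates *)

Section Point.
Variable K : fieldType.
Implicit Types (x y z : K) (P : 'rV[K]_3).

Definition pt x y z : 'rV[K]_3 := \row_i [:: x; y; z]`_i.

Lemma pt0 x y z : pt x y z 0 0 = x. Proof. by rewrite mxE. Qed.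
Lemma pt1 x y z : pt x y z 0 1 = y. Proof. by rewrite mxE. Qed.
Lemma pt2 x y z : pt x y z 0 2 = z. Proof. by rewrite mxE. Qed.
Definition ptE := (pt0, pt1, pt2).

Lemma ord3P (T : 'I_3 -> Prop) : T 0 -> T 1 -> T 2 -> forall i, T i.
Proof.
move=> T0 T1 T2 [[|[|[|//]]] lti].
- by rewrite (_ : Ordinal lti = 0) //; apply: val_inj.
- by rewrite (_ : Ordinal lti = 1) //; apply: val_inj.
- by rewrite (_ : Ordinal lti = 2) //; apply: val_inj.
Qed.

Lemma ptP (P Q : 'rV[K]_3) :
  P 0 0 = Q 0 0 -> P 0 1 = Q 0 1 -> P 0 2 = Q 0 2 -> P = Q.
Proof. by move=> h0 h1 h2; apply/rowP; apply: ord3P. Qed.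

Lemma pt_eta P : P = pt (P 0 0) (P 0 1) (P 0 2).
Proof. by apply: ptP; rewrite ptE. Qed.

Lemma pt_eq0 x y z : (pt x y z == 0) = [&& x == 0, y == 0 & z == 0].
Proof.
apply/eqP/and3P => [/rowP h|[/eqP-> /eqP-> /eqP->]]; last first.
  by apply: ptP; rewrite ptE mxE.
by split; apply/eqP; [have := h 0|have := h 1|have := h 2]; rewrite ptE mxE.
Qed.

End Point.

(** * Derivatives of and substitution into variables *)

Section Mpoly.
Variable K : fieldType.

Lemma mderivXU n (i j : 'I_n) :
  ('X_j : {mpoly K[n]})^`M(i) = (i == j)%:R.
Proof.
rewrite mderivX mnm1E eq_sym; case: eqP => [->|_]; last by rewrite scale0r.
rewrite scale1r (_ : (_ - _)%MM = 0%MM) ?mpolyX0 //.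
by apply/mnmP => k; rewrite mnmBE subnn mnm0E.
Qed.

Lemma comp_mpoly_mkXU n k (F : 'I_n -> {mpoly K[k]}) i :
  'X_i \mPo [tuple F i | i < n] = F i.
Proof. by rewrite comp_mpolyXU nth_mktuple. Qed.

End Mpoly.

(** * Values and gradient of the cubic *)

Section E6Cubic.
Variable K : fieldType.

Lemma E6_cubicE (d e f g : K) v :
  (E6_cubic d e f g).@[v] = v 0 ^+ 3 + v 1 ^+ 3 - (d * (v 0 * v 1 * v 2)
     + e * (v 0 * v 2 ^+ 2) + f * (v 1 * v 2 ^+ 2) + g * v 2 ^+ 3).
Proof.
by rewrite /E6_cubic !(mevalB, mevalD, mevalZ, mevalM, rmorphXn) /= !mevalXU.
Qed.

Lemma gradient_E6 (d e f g : K) P :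
  gradient (E6_cubic d e f g) P =
  let x := P 0 0 in let y := P 0 1 in let z := P 0 2 in
    pt (3 * x ^+ 2 - d * y * z - e * z ^+ 2)
       (3 * y ^+ 2 - d * x * z - f * z ^+ 2)
       (- (d * x * y + 2 * e * x * z + 2 * f * y * z + 3 * g * z ^+ 2)).
Proof.
(* Powers are expanded into products so that the product rule applies to them. *)
apply: ptP; rewrite /= !ptE /E6_cubic mxE !exprS !expr0;
  rewrite !(mderivB, mderivD, mderivZ, mderivM, mderivXU, mderivC) /=;
  rewrite !(mevalB, mevalD, mevalZ, mevalM, mevalXU, meval0, meval1) /=; ring.
Qed.

End E6Cubic.

(** These equations express the vanishing of the gradient at (a : b : 1), solved for [e], [f] and
    then [g]. *)
Definition singular_at (K : fieldType) (d e f g a b : K) : Prop :=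
  [/\ e = 3 * a ^+ 2 - d * b, f = 3 * b ^+ 2 - d * a
    & g = d * a * b - 2 * a ^+ 3 - 2 * b ^+ 3].

(** Used to derive an equation from a hypothesis [L = M] with an explicit multiplier [c]; what
    remains is an identity for [ring] or [field]. *)
Lemma eq_of_scaled_eq (K : fieldType) (c A B L M : K) :
  L = M -> A - B = c * (L - M) -> A = B.
Proof. by move=> ->; rewrite subrr mulr0 => /eqP; rewrite subr_eq0 => /eqP. Qed.

(** * Singular points and the discriminant locus N *)

Section Discriminant.
Variable K : numClosedFieldType.
Implicit Types (a b d e f g : K).

Let cube_eq0 (x : K) : (x ^+ 3 == 0) = (x == 0).
Proof. by rewrite expf_eq0. Qed.

Lemma E6_F_singular d e f g a b : singular_at d e f g a b ->
  E6_F d e f g = - (d ^+ 2 - 36 * a * b) ^+ 2 / 48.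
Proof. by case=> -> -> ->; rewrite /E6_F; field. Qed.

Lemma E6_G_singular d e f g a b : singular_at d e f g a b ->
  E6_G d e f g = - (d ^+ 2 - 36 * a * b) ^+ 3 / 864.
Proof. by case=> -> -> ->; rewrite /E6_G; field. Qed.

Lemma singular_at_locusN d e f g a b :
  singular_at d e f g a b -> locusN (d, e, f, g).
Proof.
move=> sE; rewrite /locusN /= (E6_F_singular sE) (E6_G_singular sE).
by field.
Qed.

Lemma singular_at_locusC d e f g a b : singular_at d e f g a b ->
  locusC (d, e, f, g) <-> d ^+ 2 = 36 * a * b.
Proof.
move=> sE; rewrite /locusC /= (E6_F_singular sE) (E6_G_singular sE).
split=> [[/eqP]|->]; last by rewrite subrr; split; field.
by rewrite mulf_eq0 invr_eq0 pnatr_eq0 orbF oppr_eq0 expf_eq0 /= subr_eq0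
  => /eqP.
Qed.

Lemma sqrt_exists (x : K) : exists y, x = y ^+ 2.
Proof. by exists (sqrtC x); rewrite sqrtCK. Qed.

(** The formulas parametrize the cuspidal curve 4 F^3 + 27 G^2 = 0: away from the cusp F = G = 0
    they force t = 18 G / F, and at the cusp t = 0. *)
Lemma locusN_delta d e f g : locusN (d, e, f, g) ->
  exists t, E6_F d e f g = - t ^+ 2 / 48 /\ E6_G d e f g = - t ^+ 3 / 864.
Proof.
rewrite /locusN /=; set F := E6_F _ _ _ _; set G := E6_G _ _ _ _ => FG0.
have [F0|nzF] := eqVneq F 0.
  exists 0; rewrite F0; split; first by field.
  move/eqP: FG0; rewrite F0 expr0n mulr0 add0r mulf_eq0 pnatr_eq0 /=.
  by rewrite expf_eq0 /= => /eqP->; field.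
have F3 : F ^+ 3 = - 27 / 4 * G ^+ 2.
  by apply: (eq_of_scaled_eq (c := 4^-1) FG0); field.
exists (18 * G / F); split.
  transitivity (F ^+ 3 / F ^+ 2); first by field.
  by rewrite F3; field.
transitivity (F ^+ 3 * G / F ^+ 3); first by field.
by rewrite {1}F3; field.
Qed.

(** The singular point is sought on the line rho^2 x + y + (d rho / 3) z = 0, which gives [b] in
    terms of [a]. Then e = 3 a^2 - d b is a quadratic equation in [a], of discriminant 12 e - 3 d^2
    rho. *)
Lemma locusQ_singular d e f g :
  locusQ (d, e, f, g) -> exists a b, singular_at d e f g a b.
Proof.
case=> rho [rho3 -> ->].
have [s s2] := sqrt_exists (12 * e - 3 * d ^+ 2 * rho).
have -> : e = (s ^+ 2 + 3 * d ^+ 2 * rho) / 12 by rewrite -s2; field.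
set a := (s - d * rho ^+ 2) / 6.
exists a, (- rho ^+ 2 * a - d * rho / 3).
by rewrite /a; split; field: rho3.
Qed.

Lemma eq_or_opp (x y : K) : x ^+ 2 = y ^+ 2 -> x = y \/ x = - y.
Proof. by move/eqP; rewrite eqf_sqr => /orP[]/eqP->; [left|right]. Qed.

(** For d = 0 the values of e and f determine a and b up to signs. The sign of the product a b is
    fixed by t = - 36 a b, the common sign of a and b by g. *)
Lemma locusN_singular0 e f g :
  locusN (0, e, f, g) -> exists a b, singular_at 0 e f g a b.
Proof.
case/locusN_delta=> t [hF hG].
have [a0 ha] := sqrt_exists (e / 3).
have [b0 hb] := sqrt_exists (f / 3).
have [a [b [ea eb ht]]] : exists a b,
    [/\ e = 3 * a ^+ 2, f = 3 * b ^+ 2 & t = - 36 * a * b].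
  have ea : e = 3 * a0 ^+ 2 by rewrite -ha; field.
  have eb : f = 3 * b0 ^+ 2 by rewrite -hb; field.
  have : t ^+ 2 = (36 * a0 * b0) ^+ 2.
    move: hF; rewrite ea eb /E6_F => hF.
    by apply: (eq_of_scaled_eq (c := - 48) (esym hF)); field.
  case/eq_or_opp=> ->; last by exists a0, b0; split=> //; ring.
  by exists a0, (- b0); split=> //; rewrite ?sqrrN //; ring.
have : g ^+ 2 = (2 * a ^+ 3 + 2 * b ^+ 3) ^+ 2.
  move: hG; rewrite ea eb ht /E6_G => hG.
  by apply: (eq_of_scaled_eq (c := 4 / 27) hG); field.
case/eq_or_opp=> ->.
  by exists (- a), (- b); split; rewrite ?ea ?eb; ring.
by exists a, b; split; rewrite ?ea ?eb; ring.
Qed.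

(* With [d <> 0], [g] is eliminated through [F = - t^2 / 48]; then
   [G = - t^3 / 864] becomes the following relation, in terms of
   [k = - (3 d^2 + t) / 4] and of the determinant [D = k^2 - 9 e f] of the
   linear system [k a - 3 e b = d f], [k b - 3 f a = d e] satisfied by any
   singular point [(a, b)]. *)
Lemma locusN_relation d e f g : d != 0 -> locusN (d, e, f, g) ->
  exists k : K, let D := k ^+ 2 - 9 * e * f in
  27 * d * g = - 2 * D - d ^+ 4 - 3 * k * d ^+ 2 /\
  27 * (e ^+ 3 + f ^+ 3) * d ^+ 2 =
    D ^+ 2 + 3 * D * k * d ^+ 2 - 2 * k ^+ 3 * d ^+ 2.
Proof.
move=> nzd /locusN_delta[t [hF hG]]; exists (- (3 * d ^+ 2 + t) / 4) => D.
have eg : 27 * d * g = - 2 * D - d ^+ 4 - 3 * (- (3 * d ^+ 2 + t) / 4) * d ^+ 2.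
  move: hF; rewrite /E6_F /D => hF.
  by apply: (eq_of_scaled_eq (c := 6) hF); field.
split=> //; move: hG.
have -> : g =
    (- 2 * D - d ^+ 4 - 3 * (- (3 * d ^+ 2 + t) / 4) * d ^+ 2) / (27 * d).
  by rewrite -eg; field.
rewrite /E6_G /D => hG.
by apply: (eq_of_scaled_eq (c := - 27 * d ^+ 2) hG); field.
Qed.

Lemma locusN_singular d e f g :
  locusN (d, e, f, g) -> exists a b, singular_at d e f g a b.
Proof.
have [->|nzd] := eqVneq d 0; first exact: locusN_singular0.
case/(locusN_relation nzd)=> k; set D := k ^+ 2 - _ => -[hg hrel].
have eg : g = (- 2 * D - d ^+ 4 - 3 * k * d ^+ 2) / (27 * d).
  by rewrite -hg; field.
have [D0|nzD] := eqVneq D 0.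
  apply: locusQ_singular.
  have k2 : k ^+ 2 = 9 * e * f by apply/eqP; rewrite -subr_eq0; apply/eqP.
  have es : 27 * (e ^+ 3 + f ^+ 3) = - 2 * k ^+ 3.
    apply: (eq_of_scaled_eq (c := (d ^+ 2)^-1) hrel).
    by rewrite D0; field.
  have k6 : k ^+ 6 = 729 * e ^+ 3 * f ^+ 3.
    by rewrite (exprM k 2 3) k2; ring.
  (* The numbers - 27 e^3 and - 27 f^3 have sum 2 k^3 and product k^6, so both equal k^3: the square
     of k^3 + 27 e^3 vanishes. *)
  have k3 : k ^+ 3 = - 27 * e ^+ 3.
    apply/eqP; rewrite -subr_eq0 -sqrf_eq0; apply/eqP.
    transitivity (k ^+ 6 + 54 * k ^+ 3 * e ^+ 3 + 729 * e ^+ 6); first by ring.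
    by rewrite k6; apply: (eq_of_scaled_eq (c := 27 * e ^+ 3) es); ring.
  have ef3 : f ^+ 3 = e ^+ 3.
    by apply: (eq_of_scaled_eq (c := 27^-1) es); rewrite k3; field.
  have [e0|nze] := eqVneq e 0.
    move/eqP: ef3; rewrite e0 expr0n /= expf_eq0 /= => /eqP f0.
    have k0 : k = 0 by move/eqP: k3; rewrite e0 expr0n mulr0 expf_eq0 => /eqP.
    (* With e = f = 0 any cube root of unity would do. *)
    exists 1; split; rewrite ?expr1n ?mul1r ?f0 //.
    by rewrite eg D0 k0; field.
  have nzf : f != 0 by rewrite -cube_eq0 ef3 expf_eq0.
  (* Both k^3 and k^2 are known, and k is their quotient. *)
  have kE : k = - 3 * (f / e) ^+ 2 * e.
    transitivity (k ^+ 3 / k ^+ 2).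
      field; rewrite -cube_eq0 k3 mulf_eq0 oppr_eq0.
      by rewrite pnatr_eq0 /= expf_eq0.
    rewrite k3 k2; transitivity (- 3 * e ^+ 3 / (f * e)).
      by field; rewrite nze.
    by rewrite -ef3; field; rewrite nze.
  exists (f / e); split; first by rewrite expr_div_n ef3 divff ?expf_neq0.
    by field.
  by rewrite eg D0 kE; field; rewrite nze.
(* Cramer's rule for the linear system of determinant [D]. *)
pose a := d * (f * k + 3 * e ^+ 2) / D.
pose b := d * (e * k + 3 * f ^+ 2) / D.
have la : k * a - 3 * e * b = d * f by rewrite /a /b /D; field.
have lb : k * b - 3 * f * a = d * e by rewrite /a /b /D; field.
(* With k = - (3 d^2 + t) / 4 this is the expected t = d^2 - 36 a b. *)
have ab : 9 * a * b = d ^+ 2 + k.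
  apply: (eq_of_scaled_eq (c := k / D ^+ 2) hrel).
  by rewrite /a /b /D; field.
(* The defects [u], [v] of the equations for e and f satisfy the homogeneous system 3 b u + d v = 0,
   d u + 3 a v = 0, whose determinant is 9 a b - d^2 = k. *)
pose u := e + d * b - 3 * a ^+ 2; pose v := f + d * a - 3 * b ^+ 2.
have uv : 3 * b * u = - d * v.
  have -> : 3 * b * u = 3 * e * b + 3 * d * b ^+ 2 - a * (9 * a * b).
    by rewrite /u; ring.
  by rewrite ab; apply: (eq_of_scaled_eq (c := - 1) la); rewrite /v; ring.
have vu : 3 * a * v = - d * u.
  have -> : 3 * a * v = 3 * f * a + 3 * d * a ^+ 2 - b * (9 * a * b).
    by rewrite /v; ring.
  by rewrite ab; apply: (eq_of_scaled_eq (c := - 1) lb); rewrite /u; ring.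
have [u0 v0] : u = 0 /\ v = 0.
  have ku : k * u = 0.
    transitivity (9 * a * b * u - d ^+ 2 * u); first by rewrite ab; ring.
    transitivity (3 * a * (3 * b * u) - d ^+ 2 * u); first by ring.
    rewrite uv; transitivity (- d * (3 * a * v) - d ^+ 2 * u); first by ring.
    by rewrite vu; ring.
  have kv : k * v = 0.
    transitivity (9 * a * b * v - d ^+ 2 * v); first by rewrite ab; ring.
    transitivity (3 * b * (3 * a * v) - d ^+ 2 * v); first by ring.
    rewrite vu; transitivity (- d * (3 * b * u) - d ^+ 2 * v); first by ring.
    by rewrite uv; ring.
  have [k0|nzk] := eqVneq k 0; last first.
    move/eqP: ku; move/eqP: kv; rewrite !mulf_eq0 (negPf nzk) /=.
    by move=> /eqP-> /eqP->.
  have /andP[nze nzf] : (e != 0) && (f != 0).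
    move: nzD; rewrite /D k0; apply: contraR; rewrite negb_and !negbK.
    by case/orP=> /eqP->; apply/eqP; ring.
  (* For k = 0 the point is explicit, a = - d e / (3 f) and b = - d f / (3 e), and each defect is a
     multiple of the relation [hrel]. *)
  move: hrel; rewrite /u /v /a /b /D k0 => hrel; split.
    apply: (eq_of_scaled_eq (c := - (81 * e * f ^+ 2)^-1) hrel).
    by field; rewrite nze nzf.
  apply: (eq_of_scaled_eq (c := - (81 * e ^+ 2 * f)^-1) hrel).
  by field; rewrite nze nzf.
have eE : e = 3 * a ^+ 2 - d * b.
  by apply: (eq_of_scaled_eq (c := 1) u0); rewrite /u; ring.
have fE : f = 3 * b ^+ 2 - d * a.
  by apply: (eq_of_scaled_eq (c := 1) v0); rewrite /v; ring.
have kE : k = 9 * a * b - d ^+ 2 by rewrite ab; ring.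
exists a, b; split=> //.
by rewrite eg /D; move: (a) (b) eE fE kE => a' b' -> -> ->; field.
Qed.

End Discriminant.

(** * Factorizations and irreducibility of cubic forms *)

Section Irreducibility.
Variables (K : fieldType) (n : nat).
Implicit Types (p q l : {mpoly K[n]}).

Lemma pihomog_small d p : (msize p <= d)%N -> pihomog mdeg d p = 0.
Proof.
move=> pd; rewrite pihomogE big_seq_cond big1 // => m /andP[/msize_mdeg_lt].
by move=> /leq_trans/(_ pd) + /eqP md; rewrite md ltnn.
Qed.

Lemma msize_sub_pihomog d p :
  (msize p <= d.+1)%N -> (msize (p - pihomog mdeg d p) <= d)%N.
Proof.
move=> pd; rewrite {1}(pihomog_partitionE pd) big_ord_recr /= addrK.
apply: leq_trans (msize_sum _ _ _) _; apply/bigmax_leqP_seq => i _ _.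
have /dhomogP hi := pihomogP mdeg i p.
rewrite msizeE; apply/bigmax_leqP_seq => m mi _.
by rewrite hi.
Qed.

(** As [msize] is the degree plus one, the bounds read deg p < i and deg q <= j. Zero factors, of
    [msize] 0, are treated apart. *)
Lemma msizeM_leq p q i j :
  (msize p <= i)%N -> (msize q <= j.+1)%N -> (msize (p * q) <= i + j)%N.
Proof.
move=> pi qj.
have [->|nzp] := eqVneq p 0; first by rewrite mul0r msize0.
have [->|nzq] := eqVneq q 0; first by rewrite mulr0 msize0.
by rewrite msizeM // -ltnS prednK ?addn_gt0 ?lt0n ?msize_poly_eq0 ?nzp //
  -addnS leq_add.
Qed.

(** Replacing each factor by its top part changes the product only by terms of degree less than i +
    j. *)
Lemma pihomogM_top i j p q :
  (msize p <= i.+1)%N -> (msize q <= j.+1)%N ->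
  pihomog mdeg (i + j) (p * q) = pihomog mdeg i p * pihomog mdeg j q.
Proof.
move=> pi qj; set p' := pihomog _ i p; set q' := pihomog _ j q.
have sp' : (msize (p - p') <= i)%N by exact: msize_sub_pihomog.
have sq' : (msize (q - q') <= j)%N by exact: msize_sub_pihomog.
have -> : p * q = p' * q' + ((p - p') * q + (q - q') * p') by ring.
have hp' : p' \is i.-homog by exact: pihomogP.
have hq' : q' \is j.-homog by exact: pihomogP.
rewrite !pihomogD (pihomog_dE (dhomogM hp' hq')) !pihomog_small ?addr0 //.
  rewrite addnC; apply: msizeM_leq => //.
  rewrite msizeE; apply/bigmax_leqP_seq => m mp _.
  by have /dhomogP-> := hp'.
by apply: msizeM_leq.
Qed.

Lemma mpoly_unitE p : p != 0 -> (p \is a GRing.unit) = (msize p == 1%N).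
Proof.
move=> nzp; apply/idP/idP => [/unitrP[q [qp _]]|/msize_poly1P[c nzc ->]].
  have nzq : q != 0.
    by apply/eqP => q0; move/eqP: qp; rewrite q0 mul0r eq_sym oner_eq0.
  have := congr1 (fun r => msize r) qp; rewrite msizeM // msize1.
  have: (0 < msize p)%N by rewrite lt0n msize_poly_eq0.
  have: (0 < msize q)%N by rewrite lt0n msize_poly_eq0.
  case: (msize q) => [|j] // _; case: (msize p) => [|[|i]] // _.
  by rewrite addSn /= !addnS.
by apply/unitrP; exists c^-1%:MP; rewrite -!mpolyCM divff // mulVf.
Qed.

Lemma linear_formE l : l \is 1.-homog -> l = \sum_i l@_U_(i) *: 'X_i.
Proof.
move=> hl; apply/mpolyP => m; rewrite raddf_sum /=.
under eq_bigr => i _ do rewrite mcoeffZ mcoeffX.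
have [/mdeg1P[j /eqP->]|m1] := boolP (mdeg m == 1%N).
  rewrite (bigD1 j) //= eqxx mulr1 big1 ?addr0 // => i nij.
  case: eqP => [/mnmP/(_ i)|_]; rewrite ?mulr0 //.
  by rewrite !mnm1E eqxx (eq_sym j) (negPf nij).
rewrite (dhomog_nemf_coeff hl m1) big1 // => i _.
by case: eqP => [mE|]; rewrite ?mulr0 //; move: m1; rewrite -mE mdeg1.
Qed.

Lemma linear_form_eval l : l \is 1.-homog ->
  forall v, l.@[v] = \sum_i l@_U_(i) * v i.
Proof.
move=> hl v; rewrite {1}(linear_formE hl) raddf_sum /=.
by apply: eq_bigr => i _; rewrite mevalZ mevalXU.
Qed.

Lemma linear_form_neq0 l : l \is 1.-homog -> l != 0 ->
  exists i, l@_U_(i) != 0.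
Proof.
move=> hl nzl; apply/existsP; apply: contraR nzl => /existsPn l0.
rewrite (linear_formE hl) big1 // => i _.
by have := l0 i; rewrite negbK => /eqP->; rewrite scale0r.
Qed.

(* A factorization of a cubic form yields one in which both factors are forms,
   by taking the parts of highest degree; one of them is then linear. *)
Lemma irreducible_cubic p : p != 0 -> p \is 3.-homog ->
  (forall l q, l != 0 -> l \is 1.-homog -> p = l * q -> False) ->
  irreducible_mpoly p.
Proof.
move=> nzp hp noline.
have lines q1 q2 : q1 != 0 -> q2 != 0 -> p = q1 * q2 -> msize q1 = 2%N ->
    msize q2 = 3%N -> False.
  move=> nz1 nz2 pE s1 s2.
  have : pihomog mdeg 3 (q1 * q2) = _ :=
    @pihomogM_top 1 2 q1 q2 (eq_leq s1) (eq_leq s2).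
  rewrite -pE (pihomog_dE hp) => pE'.
  apply: (noline _ _ _ _ pE'); last exact: pihomogP.
  by apply/eqP => l0; move: nzp; rewrite pE' l0 mul0r eqxx.
have sp : msize p = 4%N.
  have /dhomogP/(_ _ (mlead_supp nzp)) lead3 := hp.
  by rewrite -mlead_deg // lead3.
split=> // [|q1 q2 pE]; first by rewrite mpoly_unitE // sp.
have /norP[nz1 nz2] : ~~ ((q1 == 0) || (q2 == 0)) by rewrite -mulf_eq0 -pE.
have := sp; rewrite {1}pE msizeM // => s12.
have : (0 < msize q1)%N by rewrite lt0n msize_poly_eq0.
have : (0 < msize q2)%N by rewrite lt0n msize_poly_eq0.
rewrite !mpoly_unitE // => s2 s1.
(* The two sizes are positive and add up to 5, the degrees adding up to 3. *)
have [->|[[m1 m2]|[[m1 m2]|->]]] : msize q1 = 1%N \/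
    (msize q1 = 2%N /\ msize q2 = 3%N) \/
    (msize q1 = 3%N /\ msize q2 = 2%N) \/ msize q2 = 1%N.
- by move: s1 s2 s12; move: (msize q1) (msize q2) => m1 m2; lia.
- by left.
- by exfalso; apply: (lines q1 q2).
- by exfalso; apply: (lines q2 q1); rewrite 1?mulrC.
- by right.
Qed.

End Irreducibility.

(** * The cubic in coordinates centered at a singular point *)

Section LocalEquation.
Variable K : numClosedFieldType.
Implicit Types (a b d e f g u v x y z : K).

Lemma sum3 (V : nmodType) (F : 'I_3 -> V) : \sum_i F i = F 0 + F 1 + F 2.
Proof.
rewrite !big_ord_recl big_ord0 addr0 addrA.
by congr (_ + _ + _); congr F; apply: val_inj.
Qed.

Lemma dhomogXU n i : ('X_i : {mpoly K[n]}) \is 1.-homog.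
Proof. by rewrite dhomogX /= mdeg1. Qed.

Lemma E6_homog d e f g : E6_cubic d e f g \is 3.-homog.
Proof.
have hX i : ('X_i : {mpoly K[3]}) \is 1.-homog by exact: dhomogXU.
have hXn i k : ('X_i ^+ k : {mpoly K[3]}) \is k.-homog.
  by rewrite -[X in X.-homog]mul1n dhomogMn.
apply: rpredB; first by apply: rpredD; exact: hXn.
apply: rpredD; last by apply/rpredZ/hXn.
apply: rpredD; last exact/rpredZ/(dhomogM (hX 1) (hXn 2 2%N)).
apply: rpredD; last exact/rpredZ/(dhomogM (hX 0) (hXn 2 2%N)).
exact/rpredZ/(dhomogM (dhomogM (hX 0) (hX 1)) (hX 2)).
Qed.

Lemma E6_neq0 d e f g : E6_cubic d e f g != 0.
Proof.
apply/eqP => E0; have /eqP := E6_cubicE d e f g (pt 1 0 0 0).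
rewrite E0 meval0 !ptE eq_sym => /eqP.
have -> : 1 ^+ 3 + 0 ^+ 3 - (d * (1 * 0 * 0) + e * (1 * 0 ^+ 2)
   + f * (0 * 0 ^+ 2) + g * 0 ^+ 3) = 1 :> K by ring.
by move/eqP; rewrite oner_eq0.
Qed.

Lemma cube_root1 : exists w : K, w ^+ 2 + w + 1 = 0.
Proof.
have [s s2] := sqrt_exists (- 3 : K).
by exists ((- 1 + s) / 2); field: (esym s2).
Qed.

Lemma eq0_of_cube_eq0 (x : K) : x ^+ 3 = 0 -> x = 0.
Proof. by move/eqP; rewrite expf_eq0 => /eqP. Qed.

(** Membership in the curve follows from the vanishing of the gradient by Euler's formula for a form
    of degree 3. *)
Lemma singular_pointE d e f g P :
  singular_point (E6_cubic d e f g) P <-> P != 0 /\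
  let x := P 0 0 in let y := P 0 1 in let z := P 0 2 in
  [/\ 3 * x ^+ 2 - d * y * z - e * z ^+ 2 = 0,
      3 * y ^+ 2 - d * x * z - f * z ^+ 2 = 0 &
      d * x * y + 2 * e * x * z + 2 * f * y * z + 3 * g * z ^+ 2 = 0].
Proof.
rewrite /singular_point /on_curve gradient_E6 E6_cubicE /=; split.
  case=> -[nzP _] /eqP; rewrite pt_eq0 oppr_eq0 => /and3P[/eqP-> /eqP-> /eqP->].
  by [].
case=> nzP [hx hy hz]; split; last first.
  by rewrite hx hy hz oppr0; apply: ptP; rewrite ptE mxE.
split=> //.
set x := P 0 0 in hx hy hz *; set y := P 0 1 in hx hy hz *.
set z := P 0 2 in hx hy hz *.
transitivity ((x * (3 * x ^+ 2 - d * y * z - e * z ^+ 2)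
  + y * (3 * y ^+ 2 - d * x * z - f * z ^+ 2)
  - z * (d * x * y + 2 * e * x * z + 2 * f * y * z + 3 * g * z ^+ 2)) / 3).
  by field.
by rewrite hx hy hz; ring.
Qed.

Lemma singular_at_point d e f g a b : singular_at d e f g a b ->
  singular_point (E6_cubic d e f g) (pt a b 1).
Proof.
case=> -> -> ->; apply/singular_pointE; rewrite pt_eq0 oner_eq0 !andbF /= !ptE.
by split=> //; split; ring.
Qed.

Lemma singular_curveP d e f g : singular_curve (E6_cubic d e f g) <->
  exists a b, singular_at d e f g a b.
Proof.
split=> [[P]|[a [b sE]]]; last by exists (pt a b 1); exact: singular_at_point.
case/singular_pointE; rewrite {1}(pt_eta P) pt_eq0 /=.
move: (P 0 0) (P 0 1) (P 0 2) => x y z nzP [hx hy hz].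
(* On z = 0 the first two partial derivatives reduce to 3 x^2 and 3 y^2, so x and y would vanish
   too. *)
have nzz : z != 0.
  apply: contraNneq nzP => z0; move: hx hy; rewrite z0 eqxx andbT.
  rewrite !(mulr0, expr0n, subr0) /= => /eqP hx /eqP hy; move: hx hy.
  by rewrite !mulf_eq0 pnatr_eq0 /= !orbb => /eqP-> /eqP->; rewrite eqxx.
exists (x / z), (y / z); split.
- by apply: (eq_of_scaled_eq (c := - (z ^+ 2)^-1) hx); field.
- by apply: (eq_of_scaled_eq (c := - (z ^+ 2)^-1) hy); field.
have -> : g = - (d * x * y + 2 * e * x * z + 2 * f * y * z) / (3 * z ^+ 2).
  by apply: (eq_of_scaled_eq (c := (3 * z ^+ 2)^-1) hz); field.
have -> : e = (3 * x ^+ 2 - d * y * z) / z ^+ 2.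
  by apply: (eq_of_scaled_eq (c := - (z ^+ 2)^-1) hx); field.
have -> : f = (3 * y ^+ 2 - d * x * z) / z ^+ 2.
  by apply: (eq_of_scaled_eq (c := - (z ^+ 2)^-1) hy); field.
by field.
Qed.

Lemma E6_local d e f g a b u v z : singular_at d e f g a b ->
  (E6_cubic d e f g).@[pt (u + a * z) (v + b * z) z 0] =
  u ^+ 3 + v ^+ 3 + z * (3 * a * u ^+ 2 - d * u * v + 3 * b * v ^+ 2).
Proof. by case=> -> -> ->; rewrite E6_cubicE !ptE; ring. Qed.

(* A common zero of the quadratic and cubic parts of the local equation is the
   direction of a line through the singular point contained in the curve. *)
Lemma no_line_through_singular d e f g a b : singular_at d e f g a b ->
  ~ locusQ (d, e, f, g) ->
  forall u v, u ^+ 3 + v ^+ 3 = 0 ->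
    3 * a * u ^+ 2 - d * u * v + 3 * b * v ^+ 2 = 0 -> u = 0 /\ v = 0.
Proof.
case=> eE fE gE nQ u v uv q0.
have [v0|nzv] := eqVneq v 0.
  by split=> //; apply: eq0_of_cube_eq0; rewrite -uv v0 expr0n addr0.
(* The cubic relation makes - u / v a cube root of unity, and the quadratic one then expresses b
   through a, which yields the equations of Q. *)
case: nQ; exists (- u / v).
have rho3 : (- u / v) ^+ 3 = 1.
  by apply: (eq_of_scaled_eq (c := - (v ^+ 3)^-1) uv); field.
have bE : b = - (- u / v) ^+ 2 * a - d * (- u / v) / 3.
  by apply: (eq_of_scaled_eq (c := (3 * v ^+ 2)^-1) q0); field.
move: (- u / v) rho3 bE => rho rho3 bE.
by rewrite eE fE gE bE; split=> //; field: rho3.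
Qed.

(** It suffices to exclude a line in the cubic. In centered coordinates u = x - a z, v = y - b z, a
    line is al u + be v + (al a + be b + ga) z = 0, and it passes through the singular point when
    the last coefficient is zero. *)
Lemma E6_irreducible d e f g a b : singular_at d e f g a b ->
  ~ locusQ (d, e, f, g) -> irreducible_mpoly (E6_cubic d e f g).
Proof.
move=> sE nQ.
apply: (irreducible_cubic (E6_neq0 d e f g) (E6_homog d e f g)).
move=> l q nzl hl Elq.
have lE (v : 'I_3 -> K) :
    l.@[v] = l@_U_(0) * v 0 + l@_U_(1) * v 1 + l@_U_(2) * v 2.
  by rewrite linear_form_eval // sum3.
have : [|| l@_U_(0) != 0, l@_U_(1) != 0 | l@_U_(2) != 0].
  case: (linear_form_neq0 hl nzl); apply: ord3P => ->; rewrite ?orbT //.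
move: lE; move: (l@_U_(0)) (l@_U_(1)) (l@_U_(2)) => al be ga lE nzabc.
have Ev u v z : al * u + be * v + (al * a + be * b + ga) * z = 0 ->
  u ^+ 3 + v ^+ 3 + z * (3 * a * u ^+ 2 - d * u * v + 3 * b * v ^+ 2) = 0.
  move=> luvz; rewrite -(E6_local _ _ _ sE) Elq mevalM lE !ptE.
  rewrite (_ : _ + _ + _ = 0) ?mul0r //.
  by rewrite -[RHS]luvz; ring.
have [ga0|nzga] := eqVneq (al * a + be * b + ga) 0.
  (* Along a line through the singular point, of direction (be, - al), the equation vanishes for
     every z: z = 0 isolates the cubic part, and z = 1 then the quadratic one. *)
  have Ez z := Ev be (- al) z.
  rewrite ga0 in Ez.
  have h0 : be ^+ 3 + (- al) ^+ 3 = 0 by rewrite -(Ez 0); ring.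
  have h1 : 3 * a * be ^+ 2 - d * be * (- al) + 3 * b * (- al) ^+ 2 = 0.
    by rewrite -[LHS]add0r -[X in X + _]h0 -[RHS](Ez 1); ring.
  have [be0 /eqP] := no_line_through_singular sE nQ h0 h1.
  rewrite oppr_eq0 => /eqP al0.
  by move: ga0 nzabc; rewrite al0 be0 !mul0r !add0r eqxx => ->; rewrite eqxx.
(* At (u, v) = (- rho, 1) the cubic part vanishes and the quadratic part does not. Choosing z so
   that the point is on the line forces z = 0, that is be = al rho. *)
have root rho : rho ^+ 3 = 1 -> be = al * rho.
  move=> rho3; apply/eqP; rewrite -subr_eq0; apply/eqP.
  have uv0 : (- rho) ^+ 3 + 1 ^+ 3 = 0 :> K by ring: rho3.
  have := Ev (- rho) 1 (- (al * - rho + be * 1) / (al * a + be * b + ga)).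
  rewrite uv0 add0r => /(_ _)/eqP.
  rewrite mulf_eq0 => H.
  have /H/orP[] : al * - rho + be * 1 + (al * a + be * b + ga) *
       (- (al * - rho + be * 1) / (al * a + be * b + ga)) = 0 by field.
    rewrite mulf_eq0 invr_eq0 (negPf nzga) orbF oppr_eq0 => /eqP <-; ring.
  move=> /eqP /(no_line_through_singular sE nQ uv0)[_ /eqP].
  by rewrite oner_eq0.
have be1 : be = al by rewrite (root 1) ?expr1n ?mulr1.
have al0 : al = 0.
  have [w w2] := cube_root1.
  have w3 : w ^+ 3 = 1.
    by apply: (eq_of_scaled_eq (c := w - 1) w2); ring.
  have nw1 : 1 - w != 0.
    apply: contra_eq_neq w2 => /eqP; rewrite subr_eq0 => /eqP <-.
    by rewrite (_ : 1 ^+ 2 + 1 + 1 = 3) ?pnatr_eq0 //; ring.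
  have : al * (1 - w) = 0 by rewrite mulrBr mulr1 -(root w w3) be1 subrr.
  by move/eqP; rewrite mulf_eq0 (negPf nw1) orbF => /eqP.
(* The line has become z = 0, on which the cubic restricts to u^3 + v^3, nonzero at (1, 0). *)
have : (1 : K) ^+ 3 + 0 ^+ 3 = 0.
  rewrite -[RHS](Ev 1 0 0); first by ring.
  by rewrite be1 al0; ring.
by rewrite expr1n expr0n addr0 => /eqP; rewrite oner_eq0.
Qed.

Lemma same_point_scale (z : K) (P Q : 'rV[K]_3) :
  z != 0 -> Q = z *: P -> same_point Q P.
Proof. by move=> nzz ->; apply/eqmxP; exact: eqmx_scale. Qed.

(** In the coordinates u, v, z centered at the known point, the derivative along z is the quadratic
    part, so this part vanishes at any singular point; by the equation the cubic part then vanishes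
    as well. *)
Lemma E6_singular_point_uniq d e f g a b : singular_at d e f g a b ->
  ~ locusQ (d, e, f, g) ->
  forall Q, singular_point (E6_cubic d e f g) Q -> same_point Q (pt a b 1).
Proof.
move=> sE nQ Q sQ.
have [[nzQ EQ] _] := sQ; case/singular_pointE: sQ => _.
set x := Q 0 0; set y := Q 0 1; set z := Q 0 2 => /= -[hx hy hz].
have := no_line_through_singular sE nQ (u := x - a * z) (v := y - b * z).
have qz : 3 * a * (x - a * z) ^+ 2 - d * (x - a * z) * (y - b * z) +
    3 * b * (y - b * z) ^+ 2 = 0.
  rewrite -[RHS]oppr0 -hz; move: hx hy.
  case: sE => -> -> -> hx hy.
  transitivity (a * (3 * x ^+ 2 - d * y * z - (3 * a ^+ 2 - d * b) * z ^+ 2)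
   + b * (3 * y ^+ 2 - d * x * z - (3 * b ^+ 2 - d * a) * z ^+ 2)
   - (d * x * y + 2 * (3 * a ^+ 2 - d * b) * x * z
      + 2 * (3 * b ^+ 2 - d * a) * y * z +
      3 * (d * a * b - 2 * a ^+ 3 - 2 * b ^+ 3) * z ^+ 2)); first by ring.
  by rewrite hx hy; ring.
have cz : (x - a * z) ^+ 3 + (y - b * z) ^+ 3 = 0.
  have := E6_local (x - a * z) (y - b * z) z sE.
  by rewrite !subrK -pt_eta EQ qz mulr0 addr0.
case/(_ cz qz) => /eqP + /eqP; rewrite !subr_eq0 => /eqP xE /eqP yE.
have QE : Q = z *: pt a b 1.
  apply: ptP; rewrite mxE ptE ?mulr1 //.
  - by rewrite -/x xE mulrC.
  - by rewrite -/y yE mulrC.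
apply: (same_point_scale _ QE); apply/eqP => z0.
by move: nzQ; rewrite QE z0 scale0r eqxx.
Qed.

Lemma affine_frame a b : is_frame (pt a b 1) (pt 1 0 0) (pt 0 1 0).
Proof.
apply: inj_row_free => w; rewrite -(hsubmxK w) mul_row_col.
rewrite -(hsubmxK (rsubmx w)) mul_row_col.
rewrite [lsubmx w]mx11_scalar [lsubmx (rsubmx w)]mx11_scalar.
rewrite [rsubmx (rsubmx w)]mx11_scalar !mul_scalar_mx.
move: (lsubmx w 0 0) (lsubmx (rsubmx w) 0 0) (rsubmx (rsubmx w) 0 0).
move=> r s t /rowP h.
have := h 2; have := h 0; have := h 1; rewrite !mxE /=.
rewrite !(mulr0, mulr1, addr0, add0r) => + + r0.
rewrite r0 !mul0r => ht hs.
have -> : t = 0 by rewrite -[RHS]ht; ring.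
have -> : s = 0 by rewrite -[RHS]hs; ring.
by rewrite !raddf0 !row_mx0.
Qed.

Definition quadratic_form a b c : {mpoly K[2]} :=
  a%:MP * 'X_0 ^+ 2 + b%:MP * 'X_0 * 'X_1 + c%:MP * 'X_1 ^+ 2.

Lemma E6_local_equation d e f g a b : singular_at d e f g a b ->
  local_equation (E6_cubic d e f g) (pt a b 1) (pt 1 0 0) (pt 0 1 0) =
  quadratic_form (3 * a) (- d) (3 * b) + ('X_0 ^+ 3 + 'X_1 ^+ 3).
Proof.
case=> -> -> ->; rewrite /local_equation /E6_cubic /quadratic_form.
rewrite !(comp_mpolyB, comp_mpolyD, comp_mpolyZ, rmorphM, rmorphXn) /=.
by rewrite !comp_mpoly_mkXU !ptE -!mul_mpolyC; ring.
Qed.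

End LocalEquation.

(** * Nodes and cusps *)

Section DoublePoints.
Variable K : numClosedFieldType.
Implicit Types (a b c d e f g s t x y : K).

Definition binary_linear s t : {mpoly K[2]} := s%:MP * 'X_0 + t%:MP * 'X_1.

Lemma binary_linear_homog s t : binary_linear s t \is 1.-homog.
Proof. by apply: rpredD; rewrite mul_mpolyC; apply/rpredZ/dhomogXU. Qed.

Let pt2d x y : 'I_2 -> K := fun i => if i == 0 then x else y.

Let binary_linear_eval s t x y :
  (binary_linear s t).@[pt2d x y] = s * x + t * y.
Proof. by rewrite mevalD !mevalM !mevalC !mevalXU. Qed.

Lemma binary_linear_eq0 s t : binary_linear s t = 0 -> s = 0 /\ t = 0.
Proof.
move=> st0; have h x y : s * x + t * y = 0.
  by rewrite -binary_linear_eval st0 meval0.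
by split; [rewrite -(h 1 0) | rewrite -(h 0 1)]; ring.
Qed.

Lemma binary_linear_not_proportional s t s' t' : s * t' - s' * t != 0 ->
  [/\ binary_linear s t != 0, binary_linear s' t' != 0 &
    ~ proportional (binary_linear s t) (binary_linear s' t')].
Proof.
move=> nz; split.
- apply: contraNneq nz => /binary_linear_eq0[-> ->].
  by rewrite mulr0 mul0r subrr.
- apply: contraNneq nz => /binary_linear_eq0[-> ->].
  by rewrite mulr0 mul0r subrr.
case=> c _ st'; move: nz; rewrite (_ : _ - _ = 0) ?eqxx //.
have h x y : s' * x + t' * y = c * (s * x + t * y).
  by rewrite -!binary_linear_eval st' mevalZ.
have := h 1 0; rewrite !(mulr1, mulr0, addr0) => ->.
have := h 0 1; rewrite !(mulr1, mulr0, add0r) => ->.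
by ring.
Qed.

Lemma quadratic_form_split a b c : b ^+ 2 - 4 * a * c != 0 ->
  exists s t s' t', s * t' - s' * t != 0 /\
    quadratic_form a b c = binary_linear s t * binary_linear s' t'.
Proof.
move=> nzdisc; have [a0|nza] := eqVneq a 0.
  exists 0, 1, b, c; rewrite a0; split; last first.
    by rewrite /quadratic_form /binary_linear; ring.
  move: nzdisc; rewrite a0 mulr0 mul0r subr0 expf_eq0 /= => nzb.
  by rewrite (_ : _ - _ = - b) ?oppr_eq0 //; ring.
have [s s2] := sqrt_exists (b ^+ 2 - 4 * a * c).
have nzs : s != 0 by apply: contraNneq nzdisc => s0; rewrite s2 s0 expr0n.
(* The factors come from the two roots of the quadratic; their determinant is the square root [s] of
   the discriminant. *)
exists a, ((b - s) / 2), 1, ((b + s) / (2 * a)); split.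
  by rewrite (_ : _ - _ = s) //; field.
have -> : c = (b ^+ 2 - s ^+ 2) / (4 * a) by rewrite -s2; field.
rewrite /quadratic_form /binary_linear.
set u := (b - s) / 2; set v := (b + s) / (2 * a).
have -> : (b ^+ 2 - s ^+ 2) / (4 * a) = u * v by rewrite /u /v; field.
have -> : b = u + a * v by rewrite /u /v; field.
by rewrite mpolyCD !mpolyCM mpolyC1; ring.
Qed.

Lemma quadratic_form_square a b c : b ^+ 2 - 4 * a * c = 0 ->
  exists s t, [/\ a = s ^+ 2, b = 2 * s * t & c = t ^+ 2].
Proof.
move=> disc0; have [s s2] := sqrt_exists a; have [t t2] := sqrt_exists c.
have : b ^+ 2 = (2 * s * t) ^+ 2.
  by apply: (eq_of_scaled_eq (c := 1) disc0); rewrite s2 t2; ring.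
case/eq_or_opp => ->; [exists s, t|exists s, (- t)]; rewrite s2 t2.
  by split.
by split=> //; ring.
Qed.

Lemma quadratic_formE s t :
  quadratic_form (s ^+ 2) (2 * s * t) (t ^+ 2) = binary_linear s t ^+ 2.
Proof. by rewrite /quadratic_form /binary_linear; ring. Qed.

Lemma quadratic_form_homog a b c : quadratic_form a b c \is 2.-homog.
Proof.
have hX i : ('X_i : {mpoly K[2]}) \is 1.-homog by exact: dhomogXU.
rewrite /quadratic_form -mulrA !mul_mpolyC.
by do ![apply: rpredD|apply: rpredZ]; apply: dhomogM (hX _) (hX _).
Qed.

Lemma homog_part_local (q c : {mpoly K[2]}) :
  q \is 2.-homog -> c \is 3.-homog ->
  [/\ homog_part 0 (q + c) = 0, homog_part 1 (q + c) = 0,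
      homog_part 2 (q + c) = q & homog_part 3 (q + c) = c].
Proof.
move=> hq hc; rewrite /homog_part !pihomogD.
rewrite (pihomog_dE hq) (pihomog_dE hc).
by rewrite !(pihomog_ne0 _ hq) // !(pihomog_ne0 _ hc) // !addr0 add0r.
Qed.

Lemma sum_cubes_homog : 'X_0 ^+ 3 + 'X_1 ^+ 3 \is [in K[2], 3.-homog].
Proof.
by apply: rpredD; rewrite -[3%N]mul1n; apply/dhomogMn/dhomogXU.
Qed.

Lemma E6_node d e f g a b : singular_at d e f g a b ->
  d ^+ 2 != 36 * a * b -> node_at (E6_cubic d e f g) (pt a b 1).
Proof.
move=> sE nzdisc; exists (pt 1 0 0), (pt 0 1 0).
split; first exact: affine_frame.
rewrite (E6_local_equation sE) /=.
have [-> -> -> _] := homog_part_local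
  (quadratic_form_homog (3 * a) (- d) (3 * b)) sum_cubes_homog.
have [|s [t [s' [t' [nz ->]]]]] :=
    @quadratic_form_split (3 * a) (- d) (3 * b).
  by move: nzdisc; rewrite -subr_eq0; congr (_ != 0); ring.
have [nz1 nz2 np] := binary_linear_not_proportional nz.
split=> //; exists (binary_linear s t), (binary_linear s' t').
by split; rewrite ?nz1 ?nz2 ?binary_linear_homog.
Qed.

(** If the tangent s u + t v divided the cubic part, its zero (t, - s) would be a common zero of the
    quadratic and cubic parts, which is excluded outside Q. If s = t = 0, such a common zero is (1,
    - 1). *)
Lemma E6_cusp d e f g a b : singular_at d e f g a b ->
  d ^+ 2 = 36 * a * b -> ~ locusQ (d, e, f, g) ->
  cusp_at (E6_cubic d e f g) (pt a b 1).
Proof.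
move=> sE disc0 nQ; exists (pt 1 0 0), (pt 0 1 0).
split; first exact: affine_frame.
rewrite (E6_local_equation sE) /=.
have [-> -> -> ->] := homog_part_local
  (quadratic_form_homog (3 * a) (- d) (3 * b)) sum_cubes_homog.
have [|s [t [aE dE bE]]] := @quadratic_form_square (3 * a) (- d) (3 * b).
  by rewrite sqrrN disc0; ring.
have nl u v : u ^+ 3 + v ^+ 3 = 0 -> s * u + t * v = 0 -> u = 0 /\ v = 0.
  move=> uv st; apply: (no_line_through_singular sE nQ uv).
  rewrite aE bE -mulNr -mulNr dE.
  by transitivity ((s * u + t * v) ^+ 2); [ring | rewrite st expr0n].
rewrite aE dE bE quadratic_formE; split=> //.
exists (binary_linear s t); split=> //; last 1 first.
- case=> h cE.
  have [||t0 /eqP] := nl t (- s).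
  + have := congr1 (fun p => p.@[pt2d t (- s)]) cE.
    rewrite mevalM binary_linear_eval mevalD !rmorphXn /= !mevalXU /= => ->.
    by ring.
  + by ring.
  rewrite oppr_eq0 => /eqP s0.
  have [||/eqP] := nl 1 (- 1); rewrite ?s0 ?t0 ?oner_eq0 //; ring.
- apply/eqP => /binary_linear_eq0[s0 t0].
  have [||/eqP] := nl 1 (- 1); rewrite ?s0 ?t0 ?oner_eq0 //; ring.
- exact: binary_linear_homog.
Qed.

Lemma E6_nodal d e f g : (locusN `\` (locusC `|` locusQ)) (d, e, f, g) ->
  nodal_irreducible (E6_cubic d e f g).
Proof.
case=> /locusN_singular[a [b sE]] nCQ.
have nC : ~ locusC (d, e, f, g) by move=> C; apply: nCQ; left.
have nQ : ~ locusQ (d, e, f, g) by move=> Q; apply: nCQ; right.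
split.
  exact: E6_irreducible sE nQ.
exists (pt a b 1); split; last exact: E6_singular_point_uniq.
by apply: (E6_node sE); apply/eqP => /(singular_at_locusC sE).
Qed.

Lemma locusCN d e f g : locusC (d, e, f, g) -> locusN (d, e, f, g).
Proof. by case=> F0 G0; rewrite /locusN /= F0 G0; ring. Qed.

(** On Q one has F = - 3 rho^2 (rho e - rho^2 d^2 / 4)^2, whose vanishing is the equation of P for
    e. *)
Lemma locusP_CQ : locusP = locusC `&` locusQ :> set (K * K * K * K).
Proof.
apply/seteqP; split=> -[[[d e] f] g] /=.
  case=> rho [rho3 fE eE gE].
  have eE' : e = rho * d ^+ 2 / 4.
    transitivity (rho ^+ 3 * e); first by rewrite rho3 mul1r.
    transitivity (rho ^+ 2 * (rho * e)); first by ring.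
    by rewrite eE; field: rho3.
  rewrite fE gE eE'; split.
    by rewrite /E6_F /E6_G; split; field: rho3.
  by exists rho; split=> //; field: rho3.
case=> -[F0 _] [rho [rho3 fE gE]].
have re : rho * e = rho ^+ 2 * d ^+ 2 / 4.
  apply/eqP; rewrite -subr_eq0 -sqrf_eq0; apply/eqP.
  move: F0; rewrite /E6_F fE gE => F0.
  by apply: (eq_of_scaled_eq (c := - rho / 3) F0); field: rho3.
exists rho; split=> //; rewrite gE.
have -> : 9 * rho ^+ 2 * e = 9 * rho * (rho * e) by ring.
by rewrite re; field: rho3.
Qed.

Lemma E6_cuspidal d e f g : (locusC `\` locusP) (d, e, f, g) ->
  cuspidal_irreducible (E6_cubic d e f g).
Proof.
case=> C; have [a [b sE]] := locusN_singular (locusCN C).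
rewrite locusP_CQ => nP; have nQ : ~ locusQ (d, e, f, g) by move=> Q; apply: nP.
split; first exact: E6_irreducible sE nQ.
exists (pt a b 1); split; last exact: E6_singular_point_uniq.
by apply: (E6_cusp sE) => //; apply/(singular_at_locusC sE).
Qed.

Lemma locusS_PT : locusS = locusP `&` locusT :> set (K * K * K * K).
Proof.
apply/seteqP; split=> -[[[d e] f] g] /=.
  case=> -> -> -> ->; split; last by split; field.
  by exists 1; split; field.
case=> -[rho [rho3 _ eE _]] [e0 f0 gE].
have d0 : d = 0.
  apply/eqP; rewrite -sqrf_eq0; apply/eqP.
  transitivity (rho ^+ 3 * d ^+ 2); first by rewrite rho3 mul1r.
  transitivity (4 * rho * (rho ^+ 2 * d ^+ 2 / 4)); first by field.
  by rewrite -eE e0; ring.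
by rewrite gE d0; split=> //; ring.
Qed.

End DoublePoints.

(** * A line and its residual conic *)

Section ReducibleCubics.
Variable K : numClosedFieldType.
Implicit Types (a b c d e f g k r s w x y z : K).

Definition linear_form a b c : {mpoly K[3]} :=
  a%:MP * 'X_0 + b%:MP * 'X_1 + c%:MP * 'X_2.

Lemma meval_linear_form a b c (v : 'I_3 -> K) :
  (linear_form a b c).@[v] = a * v 0 + b * v 1 + c * v 2.
Proof. by rewrite !mevalD !mevalM !mevalC !mevalXU. Qed.

Lemma gradient_linear_form a b c P : gradient (linear_form a b c) P = pt a b c.
Proof.
apply: ptP; rewrite ptE mxE !mderivD !mderiv_mulC !mderivXU /=;
  by rewrite !mevalD !mevalM !mevalC; ring.
Qed.

Lemma linear_form_is_line a b c : pt a b c != 0 -> is_line (linear_form a b c).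
Proof.
move=> nz; split; last first.
  by do ![apply: rpredD]; rewrite mul_mpolyC; apply/rpredZ/dhomogXU.
apply: contraNneq nz => l0; rewrite -(gradient_linear_form a b c 0) l0.
by apply/eqP/ptP; rewrite !mxE linear0 meval0.
Qed.

Lemma linear_form_not_proportional a b c a' b' c' : a * b' != a' * b ->
  ~ proportional (linear_form a b c) (linear_form a' b' c').
Proof.
move=> nz [k _ lE]; move/eqP: nz; apply.
have h x y : a' * x + b' * y = k * (a * x + b * y).
  have := congr1 (fun p => p.@[pt x y 0 0]) lE.
  by rewrite /= mevalZ !meval_linear_form !ptE !mulr0 !addr0.
have := h 1 0; rewrite !mulr1 !mulr0 !addr0 => ->.
have -> : b' = k * b by have := h 0 1; rewrite !mulr0 !mulr1 !add0r.
by ring.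
Qed.

(* The conic residual to the line [rho^2 x + y + c z = 0] in the cubic with
   parameter in the locus Q, where [d = 3 rho^2 c] and [k = rho e]. *)
Definition residual_conic rho c k : {mpoly K[3]} :=
  'X_1 ^+ 2 + rho%:MP * 'X_0 ^+ 2 + (c ^+ 2 - k)%:MP * 'X_2 ^+ 2
  - ((rho ^+ 2)%:MP * ('X_0 * 'X_1) + c%:MP * ('X_1 * 'X_2)
     + (rho ^+ 2 * c)%:MP * ('X_0 * 'X_2)).

Variables (rho c k : K).
Hypothesis rho3 : rho ^+ 3 = 1.

Let conic := residual_conic rho c k.
Let line := linear_form (rho ^+ 2) 1 c.

Lemma residual_conic_factor e : k = rho * e ->
  E6_cubic (3 * rho ^+ 2 * c) e k (rho * c * e - c ^+ 3) = conic * line.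
Proof.
move=> kE; rewrite /E6_cubic /conic /line /residual_conic /linear_form kE.
have rho3' : (rho%:MP : {mpoly K[3]}) ^+ 3 = 1 by rewrite -rmorphXn rho3.
by rewrite -!mul_mpolyC; ring: rho3'.
Qed.

Lemma meval_residual_conic (v : 'I_3 -> K) : conic.@[v] =
  v 1 ^+ 2 + rho * v 0 ^+ 2 + (c ^+ 2 - k) * v 2 ^+ 2
  - (rho ^+ 2 * (v 0 * v 1) + c * (v 1 * v 2) + rho ^+ 2 * c * (v 0 * v 2)).
Proof.
by rewrite !(mevalB, mevalD, mevalM, mevalC, rmorphXn) /= !mevalXU.
Qed.

Lemma gradient_residual_conic P : gradient conic P =
  let x := P 0 0 in let y := P 0 1 in let z := P 0 2 in
  pt (2 * rho * x - rho ^+ 2 * y - rho ^+ 2 * c * z)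
     (2 * y - rho ^+ 2 * x - c * z)
     (2 * (c ^+ 2 - k) * z - c * y - rho ^+ 2 * c * x).
Proof.
apply: ptP; rewrite /= !ptE mxE !exprS !expr0;
  rewrite !(mderivB, mderivD, mderivM, mderivXU, mderivC) /=;
  rewrite !(mevalB, mevalD, mevalM, mevalC, mevalXU, meval0, meval1) /=; ring.
Qed.

Lemma residual_conic_homog : conic \is 2.-homog.
Proof.
have hX i : ('X_i : {mpoly K[3]}) \is 1.-homog by exact: dhomogXU.
rewrite /conic /residual_conic !mul_mpolyC.
by do ![apply: rpredB|apply: rpredD|apply: rpredZ];
  apply: dhomogM (hX _) (hX _).
Qed.

(** Eliminating x and y from the linear equations of the gradient leaves - 2 k z = 0. *)
Lemma residual_conic_nonsingular : k != 0 -> nonsingular_conic conic.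
Proof.
move=> nzk; split; [| exact: residual_conic_homog |].
  apply/eqP => q0; have := meval_residual_conic (pt 0 1 0 0).
  rewrite q0 meval0 !ptE => /esym/eqP.
  rewrite (_ : _ - _ = 1) ?oner_eq0 //; ring.
case=> P [[nzP _]]; rewrite gradient_residual_conic => /eqP.
rewrite pt_eq0 => /and3P[/eqP hx /eqP hy /eqP hz].
move: nzP; rewrite (pt_eta P) pt_eq0; move: hx hy hz.
move: (P 0 0) (P 0 1) (P 0 2) => x y z hx hy hz.
have xE : x = rho * (y + c * z) / 2.
  apply: (eq_of_scaled_eq (c := rho ^+ 2 / 2) hx).
  by field: rho3.
have yE : y = c * z.
  apply: (eq_of_scaled_eq (c := 2 / 3) hy).
  by rewrite xE; field: rho3.
have z0 : z = 0.
  apply: (eq_of_scaled_eq (c := - (2 * k)^-1) hz).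
  by rewrite xE yE; field: rho3.
have y0 : y = 0 by rewrite yE z0 mulr0.
have x0 : x = 0 by rewrite xE y0 z0; ring.
by rewrite x0 y0 z0 eqxx.
Qed.

(** Parametrization of the affine points of the line by r = - y / z; the conic is met where 3 r^2 -
    3 c r + 3 c^2 = k. *)
Let meet r := pt (rho * (r - c)) (- r) 1.

Lemma meet_on_line r : on_curve line (meet r).
Proof.
split; first by rewrite pt_eq0 oner_eq0 !andbF.
by rewrite meval_linear_form !ptE; ring: rho3.
Qed.

Lemma meet_on_conic r :
  k = 3 * r ^+ 2 - 3 * c * r + 3 * c ^+ 2 -> on_curve conic (meet r).
Proof.
move=> kE; split; first by rewrite pt_eq0 oner_eq0 !andbF.
by rewrite meval_residual_conic !ptE kE; ring: rho3.
Qed.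

Lemma meet_gradient_line r : gradient line (meet r) = pt (rho ^+ 2) 1 c.
Proof. exact: gradient_linear_form. Qed.

Lemma meet_gradient_conic r : gradient conic (meet r) =
  pt (3 * rho ^+ 2 * (r - c)) (- 3 * r)
     (2 * (c ^+ 2 - k) + c * r - c * (r - c)).
Proof.
by rewrite gradient_residual_conic /= !ptE; congr (pt _ _ _); ring: rho3.
Qed.

(** The quantity 6 r - 3 c is the derivative of the quadratic in r, so r is a simple root. Up to the
    factor rho^2 it is also the minor of the two gradients on the first two coordinates. *)
Lemma meet_transversal r : k = 3 * r ^+ 2 - 3 * c * r + 3 * c ^+ 2 ->
  6 * r - 3 * c != 0 -> transversal_at conic line (meet r).
Proof.
move=> kE nz; split; [exact: meet_on_conic | exact: meet_on_line |].
rewrite meet_gradient_line meet_gradient_conic.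
(* The number 2 is the number of rows, so rank 2 is [row_free] by conversion. *)
apply/eqP; change (is_true (row_free (col_mx
  (pt (3 * rho ^+ 2 * (r - c)) (- 3 * r)
     (2 * (c ^+ 2 - k) + c * r - c * (r - c)))
  (pt (rho ^+ 2) 1 c)))).
apply: inj_row_free => w; rewrite -(hsubmxK w) mul_row_col.
rewrite [lsubmx w]mx11_scalar [rsubmx w]mx11_scalar !mul_scalar_mx.
move: (lsubmx w 0 0) (rsubmx w 0 0) => s t /rowP h.
have h0 : s * (3 * rho ^+ 2 * (r - c)) + t * rho ^+ 2 = 0.
  by have := h 0; rewrite !mxE.
have h1 : s * (- 3 * r) + t * 1 = 0 by have := h 1; rewrite !mxE.
have s0 : s = 0.
  apply: (eq_of_scaled_eq (c := rho / (6 * r - 3 * c)) h0).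
  have -> : t = 3 * s * r by apply: (eq_of_scaled_eq (c := 1) h1); ring.
  by field: rho3.
have -> : t = 0 by rewrite -[RHS]h1 s0; ring.
by rewrite s0 !raddf0 row_mx0.
Qed.

(** Eliminating x through the line turns the conic into 3 (y + r1 z) (y + r2 z). *)
Lemma meet_only r1 r2 : r1 + r2 = c -> k = 3 * c ^+ 2 - 3 * r1 * r2 ->
  forall P, on_curve conic P -> on_curve line P ->
    same_point P (meet r1) \/ same_point P (meet r2).
Proof.
move=> r12 kE P [nzP Pq] [_ Pl]; move: Pq Pl.
rewrite meval_residual_conic meval_linear_form.
have same r : P 0 1 = - (r * P 0 2) -> P 0 0 = rho * (r - c) * P 0 2 ->
    same_point P (meet r).
  move=> yE xE; have PE : P = P 0 2 *: meet r.
    by apply: ptP; rewrite mxE ptE ?yE ?xE; ring.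
  apply: (same_point_scale _ PE); apply: contraNneq nzP => z0.
  by rewrite PE z0 scale0r.
move: (P 0 0) (P 0 1) (P 0 2) same => x y z same hq hl.
have xE : x = - rho * (y + c * z).
  by apply: (eq_of_scaled_eq (c := rho) hl); ring: rho3.
have : (y + r1 * z) * (y + r2 * z) = 0.
  apply: (eq_of_scaled_eq (c := 3^-1) hq).
  by rewrite xE kE -r12; field: rho3.
move/eqP; rewrite mulf_eq0 !addr_eq0 => /orP[]/eqP yE; [left|right];
  by apply: same; rewrite // xE yE; ring.
Qed.

End ReducibleCubics.

(** * The reducible cubics over Q, P, T and S *)

Section ReducibleLoci.
Variable K : numClosedFieldType.
Implicit Types (d e f g rho : K).

Lemma locusQ_param d e f g : locusQ (d, e, f, g) ->
  exists rho c, [/\ rho ^+ 3 = 1, d = 3 * rho ^+ 2 * c, f = rho * e &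
    g = rho * c * e - c ^+ 3].
Proof.
case=> rho [rho3 fE gE]; exists rho, (d * rho / 3); split=> //.
  by field: rho3.
by rewrite gE; field: rho3.
Qed.

(** With k = rho e, being outside T gives k != 0, hence a nonsingular conic. Being outside P makes
    12 k - 27 c^2, the discriminant of 3 r^2 - 3 c r + 3 c^2 - k, nonzero, hence two distinct simple
    roots. *)
Lemma E6_conic_transversal d e f g :
  (locusQ `\` (locusP `|` locusT)) (d, e, f, g) ->
  conic_and_transversal_line (E6_cubic d e f g).
Proof.
case=> /locusQ_param[rho [c [rho3 dE fE gE]]] nPT.
have nzk : rho * e != 0.
  apply/eqP => /eqP; rewrite mulf_eq0 => /orP[/eqP r0|/eqP e0].
    by move: rho3; rewrite r0 expr0n => /eqP; rewrite eq_sym oner_eq0.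
  apply: nPT; right; rewrite /locusT /= fE e0 mulr0; split=> //.
  by rewrite gE dE e0; field: rho3.
have nzdisc : 12 * (rho * e) - 27 * c ^+ 2 != 0.
  apply/eqP => disc0; apply: nPT; left; exists rho.
  have re : rho * e = 9 * c ^+ 2 / 4.
    by apply: (eq_of_scaled_eq (c := 12^-1) disc0); field.
  split=> //; first by rewrite re dE; field: rho3.
  have rce : rho * c * e = c * (rho * e) by ring.
  by rewrite gE rce re dE; field: rho3.
have [s s2] := sqrt_exists (12 * (rho * e) - 27 * c ^+ 2).
have nzs : s != 0 by apply: contraNneq nzdisc => s0; rewrite s2 s0 expr0n.
have kE : rho * e = (s ^+ 2 + 27 * c ^+ 2) / 12 by rewrite -s2; field.
exists (residual_conic rho c (rho * e)), (linear_form (rho ^+ 2) 1 c); split.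
- exact: residual_conic_nonsingular.
- by apply: linear_form_is_line; rewrite pt_eq0 oner_eq0 andbF.
- by rewrite dE fE gE; apply: residual_conic_factor.
pose r1 := (3 * c + s) / 6; pose r2 := (3 * c - s) / 6.
exists (pt (rho * (r1 - c)) (- r1) 1), (pt (rho * (r2 - c)) (- r2) 1); split.
- apply: meet_transversal; rewrite ?kE /r1 //; first by field.
  by rewrite (_ : _ - _ = s) //; field.
- apply: meet_transversal; rewrite ?kE /r2 //; first by field.
  by rewrite (_ : _ - _ = - s) ?oppr_eq0 //; field.
- apply/negP => /andP[/sub_rVP[t tE] _]; move/negP: nzs; apply.
  have /rowP/(_ 2) := tE; rewrite [RHS]mxE !ptE mulr1 => t1.
  have /rowP/(_ 1) := tE; rewrite [RHS]mxE !ptE -t1 mul1r => /oppr_inj/eqP.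
  rewrite -subr_eq0 (_ : r1 - r2 = s / 3); last by rewrite /r1 /r2; field.
  by rewrite mulf_eq0 invr_eq0 pnatr_eq0 orbF.
- by apply: meet_only; rewrite ?kE /r1 /r2 //; field.
Qed.

(** On P that discriminant vanishes and r = c / 2 is the double root. There the gradient of the
    conic is - 3 c / 2 times that of the line, and c != 0 outside S. *)
Lemma E6_conic_tangent d e f g : (locusP `\` locusS) (d, e, f, g) ->
  conic_and_tangent_line (E6_cubic d e f g).
Proof.
case=> -[rho [rho3 fE eE gE]] nS.
have [c dE] : exists c, d = 3 * rho ^+ 2 * c.
  by exists (d * rho / 3); field: rho3.
have re : rho * e = 9 * c ^+ 2 / 4 by rewrite eE dE; field: rho3.
have gE' : g = rho * c * e - c ^+ 3.
  have rce : rho * c * e = c * (rho * e) by ring.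
  by rewrite gE rce re dE; field: rho3.
have nzc : c != 0.
  apply/eqP => c0; apply: nS; split.
  - by rewrite dE c0 mulr0.
  - transitivity (rho ^+ 2 * (rho * e)); first by ring: rho3.
    by rewrite re c0; ring.
  - by rewrite fE re c0; ring.
  - by rewrite gE dE c0; ring.
have nzk : rho * e != 0.
  by rewrite re !mulf_neq0 ?invr_eq0 ?pnatr_eq0 ?expf_neq0.
have kE : rho * e = 3 * (c / 2) ^+ 2 - 3 * c * (c / 2) + 3 * c ^+ 2.
  by rewrite re; field.
exists (residual_conic rho c (rho * e)), (linear_form (rho ^+ 2) 1 c); split.
- exact: residual_conic_nonsingular.
- by apply: linear_form_is_line; rewrite pt_eq0 oner_eq0 andbF.
- by rewrite dE fE gE'; apply: residual_conic_factor.
exists (pt (rho * (c / 2 - c)) (- (c / 2)) 1).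
have grad : gradient (residual_conic rho c (rho * e))
    (pt (rho * (c / 2 - c)) (- (c / 2)) 1) = - (3 * c / 2) *: pt (rho ^+ 2) 1 c.
  rewrite meet_gradient_conic // re.
  by apply: ptP; rewrite [RHS]mxE !ptE; field.
have nz3c : - (3 * c / 2) != 0.
  by rewrite oppr_eq0 !mulf_neq0 ?invr_eq0 ?pnatr_eq0.
have nzl : pt (rho ^+ 2) 1 c != 0 by rewrite pt_eq0 oner_eq0 andbF.
split.
- by split; [exact: meet_on_conic | exact: meet_on_line].
- by rewrite grad scaler_eq0 negb_or nz3c.
- by rewrite meet_gradient_line.
- by rewrite meet_gradient_line; exact: same_point_scale nz3c grad.
Qed.

(** This is the classical factorization of X^3 + Y^3 + Z^3 - 3 X Y Z, with Z = c z. *)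
Lemma E6_three_lines (w c : K) : w ^+ 2 + w + 1 = 0 ->
  E6_cubic (3 * c) 0 0 (- c ^+ 3) =
  linear_form 1 1 c * linear_form 1 w (w ^+ 2 * c) *
  linear_form 1 (w ^+ 2) (w * c).
Proof.
move=> w2; rewrite /E6_cubic /linear_form -!mul_mpolyC.
have w2' : (w%:MP : {mpoly K[3]}) ^+ 2 = - w%:MP - 1.
  rewrite -rmorphXn (_ : w ^+ 2 = - w - 1) ?rmorphB ?rmorphN ?mpolyC1 //.
  by apply: (eq_of_scaled_eq (c := 1) w2); ring.
rewrite !(rmorphN, rmorphM, rmorphXn, rmorph_nat, rmorph0, rmorph1) /=.
by move: (w%:MP) (c%:MP) w2' => w' c' w2'; ring: w2'.
Qed.

Lemma E6_nonconcurrent d e f g : (locusT `\` locusS) (d, e, f, g) ->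
  three_nonconcurrent_lines (E6_cubic d e f g).
Proof.
case=> -[-> -> gE] nS; have [w w2] := cube_root1 K.
have nzd : d != 0.
  by apply/eqP => d0; apply: nS; rewrite gE d0; split=> //; ring.
exists (linear_form 1 1 (d / 3)), (linear_form 1 w (w ^+ 2 * (d / 3))),
  (linear_form 1 (w ^+ 2) (w * (d / 3))).
split; try by apply: linear_form_is_line; rewrite pt_eq0 oner_eq0.
  by rewrite -E6_three_lines // gE; congr (E6_cubic _ _ _ _); field.
have w2' : w ^+ 2 = - w - 1.
  by apply: (eq_of_scaled_eq (c := 1) w2); ring.
case=> P [[nzP h1] [_ h2] [_ h3]]; move: h1 h2 h3 nzP.
rewrite !meval_linear_form (pt_eta P) pt_eq0 !ptE.
move: (P 0 0) (P 0 1) (P 0 2) => x y z h1 h2 h3.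
set l1 := (X in X = 0) in h1; set l2 := (X in X = 0) in h2.
set l3 := (X in X = 0) in h3.
(* The three linear forms are a discrete Fourier transform of (x, y, d z / 3), inverted here;
   recovering z divides by d. *)
have -> : x = (l1 + l2 + l3) / 3.
  by rewrite /l1 /l2 /l3; field: w2'.
have -> : y = (l1 + w ^+ 2 * l2 + w * l3) / 3.
  by rewrite /l1 /l2 /l3; field: w2'.
have -> : z = (l1 + w * l2 + w ^+ 2 * l3) / d.
  by rewrite /l1 /l2 /l3; field: w2'.
by rewrite h1 h2 h3 !(mulr0, addr0, mul0r) eqxx.
Qed.

Lemma E6_concurrent d e f g : locusS (d, e, f, g) ->
  three_distinct_concurrent_lines (E6_cubic d e f g).
Proof.
case=> -> -> -> ->; have [w w2] := cube_root1 K.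
have nzw : w != 0.
  apply/eqP => w0; move/eqP: w2; rewrite w0 expr0n /= !add0r.
  by rewrite oner_eq0.
have nw1 : w != 1.
  apply/eqP => w1; move/eqP: w2; rewrite w1.
  by rewrite (_ : _ + _ = 3) ?pnatr_eq0 //; ring.
have w3 : w ^+ 3 = 1.
  by apply: (eq_of_scaled_eq (c := w - 1) w2); ring.
(* The same factorization at c = 0, with the zero coefficients left unsimplified to match it. *)
exists (linear_form 1 1 0), (linear_form 1 w (w ^+ 2 * 0)),
  (linear_form 1 (w ^+ 2) (w * 0)); split.
- by split; apply: linear_form_is_line; rewrite pt_eq0 oner_eq0.
- by rewrite -E6_three_lines //; congr (E6_cubic _ _ _ _); ring.
- split; apply: linear_form_not_proportional; rewrite ?mul1r //.
    apply: contra nw1 => /eqP w21; apply/eqP.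
    by rewrite -[LHS]mulr1 -w21 -exprS w3.
  rewrite -subr_eq0 (_ : w ^+ 2 - w = w * (w - 1)); last by ring.
  by rewrite mulf_neq0 // subr_eq0.
exists (pt 0 0 1); rewrite /on_curve !meval_linear_form !ptE.
by rewrite pt_eq0 oner_eq0 !andbF; split; split=> //; ring.
Qed.

End ReducibleLoci.

Theorem mainTheorem11 (R : realType) :
  (forall d e f g : R[i],
    let E := E6_cubic d e f g in
    (singular_curve E <-> locusN (d, e, f, g)) /\
    ((locusN `\` (locusC `|` locusQ)) (d, e, f, g) ->
      nodal_irreducible E) /\
    ((locusC `\` locusP) (d, e, f, g) ->
      cuspidal_irreducible E) /\
    ((locusQ `\` (locusP `|` locusT)) (d, e, f, g) ->
      conic_and_transversal_line E) /\
    ((locusP `\` locusS) (d, e, f, g) ->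
      conic_and_tangent_line E) /\
    ((locusT `\` locusS) (d, e, f, g) ->
      three_nonconcurrent_lines E) /\
    (locusS (d, e, f, g) ->
      three_distinct_concurrent_lines E)) /\
  locusP = locusC `&` locusQ :> set (R[i] * R[i] * R[i] * R[i]) /\
  locusS = locusP `&` locusT :> set (R[i] * R[i] * R[i] * R[i]).
Proof.
split=> [d e f g E|]; last by split; [exact: locusP_CQ | exact: locusS_PT].
split; first split=> [/singular_curveP[a [b sE]]|/locusN_singular sE].
- exact: singular_at_locusN sE.
- exact/singular_curveP.
split; first exact: E6_nodal.
split; first exact: E6_cuspidal.
split; first exact: E6_conic_transversal.
split; first exact: E6_conic_tangent.
split; [exact: E6_nonconcurrent | exact: E6_concurrent].
Qed.
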